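(* Let $\Gamma$ be a group generated by a finite set $X$. Then the following are equivalent: (i) $\Gamma$ is amenable with solvable Word Problem; (ii) $\Gamma$ is recursively presentable and there exists an algorithm which on input $n\in\mathbb N$ outputs a finite set $F\subset\mathbb F_{\mathsf X}$ such that $\pi_\Gamma(F)$ is an $n$-Følner set of $\Gamma$ with respect to $X$ and $|F|=|\pi_\Gamma(F)|$.
   Context: $\mathbb N$ denotes the positive integers. $\mathsf X$ is a set with a bijection $\mathsf X\to X$, $\mathbb F_{\mathsf X}$ is the free group on $\mathsf X$, and $\pi_\Gamma\colon\mathbb F_{\mathsf X}\to\Gamma$ is the induced epimorphism. $\Gamma$ is recursively presentable if there is a recursive $R\subset\mathbb F_{\mathsf X}$ whose normal closure is $\ker\pi_\Gamma$; it has solvable Word Problem if $\ker\pi_\Gamma$ is recursive. A non-empty finite $\Omega\subset\Gamma$ is an $n$-Følner set with respect to $X$ if $|\Omega\setminus x\Omega|/|\Omega|\le n^{-1}$ for all $x\in X$. $\Gamma$ is amenable if $n$-Følner sets exist for all $n\in\mathbb N$. *)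

(* Defs.v *)
From HB Require Import structures.
From mathcomp Require Import all_boot all_order all_algebra.
From mathcomp Require Import finmap boolp classical_sets.

Set Implicit Arguments.
Unset Strict Implicit.
Unset Printing Implicit Defensive.

Local Open Scope classical_set_scope.
Local Open Scope group_scope.

(* The (total) recursive functions: the least class of functions on tuples of
   naturals containing zero, successor and the projections, and closed under
   composition, primitive recursion, and minimization whenever the latter
   yields a total function.  In the last two clauses the resulting function h
   is specified by its defining equations, and the recursion or minimization
   variable comes first. *)
Inductive recursive : forall k : nat, (k.-tuple nat -> nat) -> Prop :=
| recursive_zero : recursive (fun _ : 0.-tuple nat => 0%N)
| recursive_succ : recursive (fun t : 1.-tuple nat => (thead t).+1)
| recursive_proj (k : nat) (i : 'I_k) :
    recursive (fun t : k.-tuple nat => tnth t i)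
| recursive_comp (k m : nat) (f : m.-tuple nat -> nat)
    (g : 'I_m -> k.-tuple nat -> nat) :
    recursive f -> (forall i, recursive (g i)) ->
    recursive (fun t : k.-tuple nat => f [tuple g i t | i < m])
| recursive_prec (k : nat) (f : k.-tuple nat -> nat)
    (g : k.+2.-tuple nat -> nat) (h : k.+1.-tuple nat -> nat) :
    recursive f -> recursive g ->
    (forall t : k.-tuple nat, h [tuple of 0%N :: t] = f t) ->
    (forall (n : nat) (t : k.-tuple nat),
       h [tuple of n.+1 :: t]
       = g [tuple of n :: [tuple of h [tuple of n :: t] :: t]]) ->
    recursive h
| recursive_mu (k : nat) (f : k.+1.-tuple nat -> nat) (h : k.-tuple nat -> nat) :
    recursive f ->
    (forall t : k.-tuple nat, f [tuple of h t :: t] = 0%N) ->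
    (forall (t : k.-tuple nat) (n : nat),
       (n < h t)%N -> f [tuple of n :: t] <> 0%N) ->
    recursive h.

(* The free group on T, realized as the group of reduced words: (x, false)
   stands for the generator x and (x, true) for its inverse. *)
Section FreeGroup.
Variable T : finType.
Implicit Types (a b : T * bool) (u v w : seq (T * bool)).

Definition letter_inv a : T * bool := (a.1, ~~ a.2).

Definition reduced w : bool := sorted (fun a b => b != letter_inv a) w.

Record freeGroup := FreeGroup { word :> seq (T * bool); _ : reduced word }.

HB.instance Definition _ := [isSub for word].
HB.instance Definition _ := [Choice of freeGroup by <:].

(* The reduced form of a w, for w reduced. *)
Definition push a w :=
  if w is b :: w' then if b == letter_inv a then w' else a :: w else [:: a].

(* The reduced form of u v, for v reduced. *)
Definition word_mul u v := foldr push v u.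

Definition word_inv u := rev (map letter_inv u).

Lemma letter_invK : involutive letter_inv.
Proof. by case=> x b; rewrite /letter_inv /= negbK. Qed.

Lemma push_reduced a w : reduced w -> reduced (push a w).
Proof.
case: w => [//|b w] /=.
case: ifP => [_|ab rw]; last by rewrite /= ab.
by case: w => //= c w /andP[].
Qed.

Lemma word_mul_reduced u v : reduced v -> reduced (word_mul u v).
Proof. by move=> rv; elim: u => //= a u; apply: push_reduced. Qed.

Lemma pushK a w : reduced w -> push a (push (letter_inv a) w) = w.
Proof.
case: w => [|b w] /=; first by rewrite eqxx.
rewrite letter_invK; case: eqP => [->|_ _] /=; last by rewrite eqxx.
by case: w => //= c w /andP[/negPf ->].
Qed.

Lemma word_mul_push a u v : reduced v ->
  word_mul (push a u) v = push a (word_mul u v).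
Proof.
move=> rv; case: u => //= b u; case: eqP => //= ->.
by rewrite pushK // word_mul_reduced.
Qed.

Lemma word_mulA u v w : reduced w ->
  word_mul u (word_mul v w) = word_mul (word_mul u v) w.
Proof. by move=> rw; elim: u => //= a u ->; rewrite word_mul_push. Qed.

Lemma word_mulw1 u : reduced u -> word_mul u [::] = u.
Proof.
elim: u => //= a u IH ru; rewrite IH; last exact: path_sorted ru.
by case: u ru {IH} => //= b u /andP[/negPf ->].
Qed.

Lemma word_invK : involutive word_inv.
Proof. by move=> u; rewrite /word_inv map_rev revK (mapK letter_invK). Qed.

Lemma word_inv_reduced u : reduced u -> reduced (word_inv u).
Proof.
rewrite /reduced /word_inv rev_sorted sorted_map; apply: sub_sorted => a b /=.
by rewrite letter_invK eq_sym (inv_eq letter_invK).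
Qed.

Lemma word_mulV u : word_mul (word_inv u) u = [::].
Proof.
elim: u => //= a u IH; rewrite /word_inv /= rev_cons -cats1 /word_mul.
by rewrite foldr_cat /= letter_invK eqxx.
Qed.

Definition fg_one := @FreeGroup [::] isT.
Definition fg_mul (u v : freeGroup) :=
  FreeGroup (word_mul_reduced u (valP v)).
Definition fg_inv (u : freeGroup) := FreeGroup (word_inv_reduced (valP u)).

Lemma fg_mulA : associative fg_mul.
Proof. by move=> u v w; apply: val_inj; rewrite /= word_mulA // (valP w). Qed.
Lemma fg_mul1 : left_id fg_one fg_mul.
Proof. by move=> u; apply: val_inj. Qed.
Lemma fg_mulr1 : right_id fg_one fg_mul.
Proof. by move=> u; apply: val_inj; rewrite /= word_mulw1 // (valP u). Qed.
Lemma fg_mulV : left_inverse fg_one fg_inv fg_mul.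
Proof. by move=> u; apply: val_inj; rewrite /= word_mulV. Qed.
Lemma fg_mulrV : right_inverse fg_one fg_inv fg_mul.
Proof.
move=> u; apply: val_inj; rewrite /= -{1}[word u]word_invK.
exact: word_mulV.
Qed.

HB.instance Definition _ :=
  isGroup.Build freeGroup fg_mulA fg_mul1 fg_mulr1 fg_mulV fg_mulrV.

(* Goedel numbers of words and of finite sequences of words; the values of
   enum_rank number the elements of T from 0 to #|T|.-1. *)
Definition letter_code a : nat := ((enum_rank a.1).*2 + a.2)%N.
Definition word_code (u : freeGroup) : nat :=
  CodeSeq.code [seq letter_code a | a <- word u].
Definition words_code (s : seq freeGroup) : nat :=
  CodeSeq.code (map word_code s).

(* m describes the finite set F as a list of its elements, in any order. *)
Definition codes_fset (m : nat) (F : {fset freeGroup}) : Prop :=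
  exists2 s : seq freeGroup, m = words_code s & F =i s.

Definition recursive_set (S : set freeGroup) : Prop :=
  exists2 f : 1.-tuple nat -> nat, recursive f &
    forall u : freeGroup, f [tuple word_code u] = (u \in S) :> nat.

End FreeGroup.

Section Groups.
Variable G : groupType.

Definition subgroup (H : set G) : Prop :=
  H 1 /\ (forall g h : G, H g -> H h -> H (g / h)).

Definition normal_subgroup (N : set G) : Prop :=
  subgroup N /\ (forall g h : G, N g -> N (g ^ h)).

Definition normal_closure (R : set G) : set G := smallest normal_subgroup R.

Definition generated_by (X : {fset G}) : Prop :=
  smallest subgroup [set` X] = [set: G].

Definition folner_set (X : {fset G}) (n : nat) (Omega : {fset G}) : Prop :=
  Omega != fset0 /\
  forall x : G, x \in X ->
    (#|` (Omega `\` [fset (x * g)%g | g in Omega])%fset |%:R / #|` Omega|%:R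
       <= n%:R^-1 :> rat)%R.

Definition amenable (X : {fset G}) : Prop :=
  forall n : nat, (0 < n)%N -> exists Omega : {fset G}, folner_set X n Omega.

End Groups.

Section MarkedGroup.
Variables (G : groupType) (X : {fset G}) (T : finType) (iota : T -> X).

Definition eval_letter (a : T * bool) : G :=
  if a.2 then (val (iota a.1))^-1 else val (iota a.1).

Definition fg_proj (u : freeGroup T) : G := \prod_(a <- word u) eval_letter a.

Lemma fg_projM (u v : freeGroup T) : fg_proj (u * v) = fg_proj u * fg_proj v.
Proof.
have evalV a : eval_letter (letter_inv a) = (eval_letter a)^-1.
  by rewrite /eval_letter /=; case: a.2; rewrite //= invgK.
rewrite /fg_proj; change (word (u * v)) with (word_mul (word u) (word v)).
elim: (word u) => [|a w IH] /=; first by rewrite big_nil mul1g.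
rewrite big_cons -mulgA -IH; case: (word_mul w (word v)) => [|b s] /=.
  by rewrite big_seq1 big_nil mulg1.
by case: eqP => [->|_]; rewrite ?big_cons // evalV mulgA mulgV mul1g.
Qed.

HB.instance Definition _ :=
  isMultiplicative.Build (freeGroup T) G fg_proj fg_projM.

Definition fg_ker : set (freeGroup T) := [set u | fg_proj u = 1].

Definition recursively_presentable : Prop :=
  exists2 R : set (freeGroup T), recursive_set R & normal_closure R = fg_ker.

Definition solvable_word_problem : Prop := recursive_set fg_ker.

End MarkedGroup.

(* Main.v *)
From HB Require Import structures.
Require Import Defs.
From mathcomp Require Import all_boot finmap.
From mathcomp Require Import all_order all_algebra boolp classical_sets.

(* (i) => (ii): the kernel is itself a recursive set of relators.  On input n,
   search for a list of words with pairwise distinct images forming an n-Folner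
   set; the word problem makes the test decidable, and amenability together
   with the surjectivity of the projection makes the search succeed.

   (ii) => (i): if Omega is n-Folner, then |Omega \ w Omega| <= |w| |Omega| / n,
   so Omega meets w Omega as soon as n > |w|.  Given w, compute the list F for
   n = |w| + 1 and enumerate the kernel as products of conjugates of relators
   until u, v in F with w u v^-1 in the kernel show up.  As F embeds into the
   group, w is trivial exactly when u = v. *)

Set Implicit Arguments.
Unset Strict Implicit.
Unset Printing Implicit Defensive.

(** * Recursive functions on natural numbers *)

Definition rec1 (f : nat -> nat) :=
  recursive (fun t : 1.-tuple nat => f (nth 0 t 0)).
Definition rec2 (f : nat -> nat -> nat) :=
  recursive (fun t : 2.-tuple nat => f (nth 0 t 0) (nth 0 t 1)).

Lemma recursive_ext k (f g : k.-tuple nat -> nat) :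
  f =1 g -> recursive f -> recursive g.
Proof. by move=> /funext ->. Qed.

Lemma recursive_nth k i : i < k -> recursive (fun t : k.-tuple nat => nth 0 t i).
Proof.
move=> ik; apply: recursive_ext (recursive_proj (Ordinal ik)) => t.
by rewrite (tnth_nth 0).
Qed.

Lemma nth_mktuple_lt k (f : 'I_k -> nat) i (ik : i < k) :
  nth 0 [tuple f j | j < k] i = f (Ordinal ik).
Proof. by rewrite -(tnth_mktuple f) (tnth_nth 0). Qed.

Lemma recursive_rec1 k f (g : k.-tuple nat -> nat) :
  rec1 f -> recursive g -> recursive (fun t => f (g t)).
Proof.
move=> rf rg; apply: recursive_ext (recursive_comp rf (fun=> rg)) => t.
by rewrite nth_mktuple_lt.
Qed.

Lemma recursive_rec2 k f (g h : k.-tuple nat -> nat) :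
  rec2 f -> recursive g -> recursive h -> recursive (fun t => f (g t) (h t)).
Proof.
move=> rf rg rh.
pose gh (i : 'I_2) := if val i == 0 then g else h.
have rgh i : recursive (gh i) by rewrite /gh; case: ifP.
apply: recursive_ext (recursive_comp rf rgh) => t.
by rewrite !nth_mktuple_lt.
Qed.

Lemma recursive_cst k c : recursive (fun _ : k.-tuple nat => c).
Proof.
elim: c => [|c IH].
  (* The zero function has arity 0; composing it with the empty family of functions raises its arity
     to [k]. *)
  by apply: recursive_ext (recursive_comp (g := ffun0 (card_ord 0)) recursive_zero _) => [t|[]].
by apply: (@recursive_rec1 _ S) IH; apply: recursive_ext recursive_succ => -[[]].
Qed.

Lemma rec1_id : rec1 id.
Proof. exact: recursive_nth. Qed.

Lemma rec1_succ : rec1 S.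
Proof. by apply: recursive_ext recursive_succ => t; rewrite /thead (tnth_nth 0). Qed.

Lemma rec2_iter f : rec1 f -> rec2 (fun n a => iter n f a).
Proof.
move=> rf.
(* The step receives the tuple (counter, previous value, start) and applies [f] to component 1
   only. *)
exact: (recursive_prec rec1_id (recursive_rec1 rf (@recursive_nth 3 1 isT))).
Qed.

Lemma rec1_nat_rec c f (h : nat -> nat) :
  rec2 f -> h 0 = c -> (forall n, h n.+1 = f n (h n)) -> rec1 h.
Proof.
by move=> rf h0 hS; apply: (recursive_prec (recursive_cst 0 c) rf) => [t|n t] /=.
Qed.

Lemma rec1_comp f g : rec1 f -> rec1 g -> rec1 (f \o g).
Proof. exact: recursive_rec1. Qed.

Lemma rec2_swap f : rec2 f -> rec2 (fun a b => f b a).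
Proof. by move=> rf; apply: (recursive_rec2 rf); apply: recursive_nth. Qed.

Lemma rec2_comp f g h : rec2 f -> rec1 g -> rec1 h -> rec1 (fun n => f (g n) (h n)).
Proof. exact: recursive_rec2. Qed.

Lemma rec1_mu f h : rec2 f -> (forall a, f (h a) a = 0) ->
  (forall a n, n < h a -> f n a <> 0) -> rec1 h.
Proof. by move=> rf h0 hn; apply: (recursive_mu rf) => [t|t n] /=; auto. Qed.

Lemma rec2_add : rec2 (fun a b => a + b).
Proof.
apply: recursive_ext (rec2_iter rec1_succ) => t /=.
by elim: (nth 0 t 0) => //= n ->.
Qed.

Lemma rec2_fst : rec2 (fun a _ => a).
Proof. exact: recursive_nth. Qed.

Lemma rec1_pred : rec1 predn.
Proof. exact: (rec1_nat_rec rec2_fst). Qed.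

Lemma rec2_sub : rec2 (fun a b => a - b).
Proof.
apply: rec2_swap.
apply: recursive_ext (rec2_iter rec1_pred) => t /=.
by elim: (nth 0 t 0) => [|n IH] /=; [rewrite subn0 | rewrite IH subnS].
Qed.

(** Primitive recursion through the identity [half n.+1 = n - half n]. *)
Lemma rec1_half : rec1 half.
Proof.
apply: (rec1_nat_rec rec2_sub) => // n.
by rewrite -[half n.+1]/(uphalf n) uphalf_half -{3}(odd_double_half n) -addnn addnA addnK.
Qed.

Lemma rec1_odd : rec1 (fun n => odd n).
Proof.
have r : rec2 (fun _ b => 1 - b).
  by apply: (recursive_rec2 rec2_sub); [exact: recursive_cst|exact: recursive_nth].
by apply: (rec1_nat_rec r) => // n /=; case: odd.
Qed.

Lemma rec1_double : rec1 double.
Proof.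
apply: recursive_ext (rec2_comp rec2_add rec1_id rec1_id) => t.
exact: addnn.
Qed.

(* Chosen so that [CodeSeq.code (a :: s) = npair a (CodeSeq.code s)]; the value
   0 is never a pair and codes the empty sequence. *)
Definition npair a b := 2 ^ a * b.*2.+1.

Lemma rec2_npair : rec2 npair.
Proof.
have r : rec2 (fun a b => iter a double b.*2.+1).
  apply: (recursive_rec2 (rec2_iter rec1_double)); first exact: recursive_nth.
  apply: (recursive_rec1 rec1_succ); apply: (recursive_rec1 rec1_double).
  exact: recursive_nth.
apply: recursive_ext r => t /=; rewrite /npair.
by elim: (nth 0 t 0) => [|n IH] /=; [rewrite mul1n | rewrite IH expnS -mulnA mul2n].
Qed.

(** For positive [m], the 2-adic valuation and the half of the odd part invert [npair]. Both
    projections send 0 to 0, so that [nsnd] also realizes [behead] on the empty list. *)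
Definition nfst m := logn 2 m.
Definition nsnd m := (m %/ 2 ^ logn 2 m)./2.

Lemma nfst_pair a b : nfst (npair a b) = a.
Proof.
by rewrite /nfst lognM ?expn_gt0 // pfactorK // lognE /= dvdn2 /= odd_double addn0.
Qed.

Lemma nsnd_pair a b : nsnd (npair a b) = b.
Proof.
by rewrite /nsnd -/(nfst _) nfst_pair /npair mulKn ?expn_gt0 //= uphalf_double.
Qed.

Lemma iter_half n m : iter n half m = m %/ 2 ^ n.
Proof.
by elim: n => [|n IH] /=; [rewrite divn1 | rewrite IH -divn2 -divnMA expnSr].
Qed.

Lemma odd_div_logn m : 0 < m -> odd (m %/ 2 ^ logn 2 m).
Proof.
move=> m0; have [q cq ->] := pfactor_coprime (erefl : prime 2) m0.
have q0 : 0 < q by case: q cq.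
rewrite coprime2n in cq.
have logq : logn 2 q = 0 by rewrite lognE dvdn2 cq !andbF.
by rewrite lognM ?expn_gt0 // pfactorK // logq mulnK ?expn_gt0.
Qed.

Lemma rec1_nfst : rec1 nfst.
Proof.
(* The valuation is the least [n] with [m / 2^n] odd. The term [1 - (1 - m)] is the sign of [m]; it
   makes the minimization stop at 0 when [m = 0], where no quotient is odd. *)
have r : rec2 (fun n m => (1 - (1 - m)) - odd (iter n half m)).
  apply: (recursive_rec2 rec2_sub).
    apply: (recursive_rec2 rec2_sub); first exact: recursive_cst.
    apply: (recursive_rec2 rec2_sub); first exact: recursive_cst.
    exact: recursive_nth.
  apply: (recursive_rec1 rec1_odd); apply: (recursive_rec2 (rec2_iter rec1_half));
    exact: recursive_nth.
apply: (rec1_mu r) => [[|m]|[|m] n] //; rewrite iter_half.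
  by rewrite odd_div_logn.
rewrite /nfst => nlt; suff /negPf -> : ~~ odd (m.+1 %/ 2 ^ n) by [].
rewrite -dvdn2 dvdn_divRL; last by rewrite pfactor_dvdn // ltnW.
by rewrite -expnS pfactor_dvdn.
Qed.

Lemma rec1_nsnd : rec1 nsnd.
Proof.
apply: (rec1_comp rec1_half).
apply: recursive_ext (rec2_comp (rec2_iter rec1_half) rec1_nfst rec1_id) => t.
exact: iter_half.
Qed.

Lemma npair_gt0 a b : 0 < npair a b.
Proof. by rewrite muln_gt0 expn_gt0. Qed.

Lemma npair_inj a b c d : npair a b = npair c d -> a = c /\ b = d.
Proof.
by move=> e; rewrite -(nfst_pair a b) -{2}(nsnd_pair a b) e nfst_pair nsnd_pair.
Qed.

(** Lets the code of a list serve as the iteration count of a loop over that list. *)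
Lemma size_code s : size s <= CodeSeq.code s.
Proof.
elim: s => //= a s IH; have p : 0 < 2 ^ a by rewrite expn_gt0.
apply: leq_trans (leq_pmull _ p).
by rewrite ltnS -addnn; apply: leq_trans IH (leq_addr _ _).
Qed.

(** * Computable functions between coded types *)

Class coding (A : Type) := Coding { enc : A -> nat; enc_inj : injective enc }.

(** The realizer [f'] is constrained on codes only; codings need not be surjective, and values
    elsewhere are arbitrary. *)
Definition computable A B {cA : coding A} {cB : coding B} (f : A -> B) :=
  exists2 f', rec1 f' & forall a, f' (enc a) = enc (f a).

#[export] Instance coding_nat : coding nat := Coding (fun _ _ e => e).

Lemma nat_of_bool_inj : injective nat_of_bool.
Proof. by case; case. Qed.
#[export] Instance coding_bool : coding bool := Coding nat_of_bool_inj.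

Lemma enc_pair_inj A B {cA : coding A} {cB : coding B} :
  injective (fun p : A * B => npair (enc p.1) (enc p.2)).
Proof. by move=> [a b] [c d] /npair_inj[ac bd]; congr pair; apply: enc_inj. Qed.
#[export] Instance coding_pair A B {cA : coding A} {cB : coding B} :
  coding (A * B) := Coding (@enc_pair_inj A B cA cB).

Lemma enc_seq_inj A {cA : coding A} :
  injective (fun s : seq A => CodeSeq.code (map enc s)).
Proof.
move=> s t /(congr1 CodeSeq.decode); rewrite !CodeSeq.codeK.
exact: (inj_map enc_inj).
Qed.
(** On lists of free group elements this coding unfolds to [words_code]. *)
#[export] Instance coding_seq A {cA : coding A} : coding (seq A) :=
  Coding (@enc_seq_inj A cA).

Lemma rec1_if c f g : rec1 c -> rec1 f -> rec1 g ->
  rec1 (fun n => if c n == 0 then g n else f n).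
Proof.
move=> rc rf rg.
(* Branching by iteration: starting from the pair of [f n] and [g n], the map sending (a, b) to (a,
   a) is applied [c n] times. The second component is then [g n] if [c n = 0], and [f n] after any
   positive number of rounds. *)
have rs : rec1 (fun m => npair (nfst m) (nfst m)).
  exact: rec2_comp rec2_npair rec1_nfst rec1_nfst.
have r := rec1_comp rec1_nsnd
  (rec2_comp (rec2_iter rs) rc (rec2_comp rec2_npair rf rg)).
apply: recursive_ext r => t /=; case: eqP => [->|] /=; first by rewrite nsnd_pair.
case: (c _) => //= k _; rewrite nsnd_pair.
by elim: k => [|k IH] /=; rewrite nfst_pair.
Qed.

Lemma rec1_cst c : rec1 (fun=> c).
Proof. exact: recursive_cst. Qed.

Lemma rec1_eq f g : rec1 f -> rec1 g -> rec1 (fun n => f n == g n).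
Proof.
move=> rf rg.
(* Two naturals are equal exactly when the sum of both truncated differences is 0. *)
have r := rec1_if
  (rec2_comp rec2_add (rec2_comp rec2_sub rf rg) (rec2_comp rec2_sub rg rf))
  (rec1_cst 0) (rec1_cst 1).
apply: recursive_ext r => t; rewrite addn_eq0 !subn_eq0 -eqn_leq.
by case: eqP.
Qed.

Section Basics.
Context {A B C : Type} {cA : coding A} {cB : coding B} {cC : coding C}.

Lemma computable_ext (f g : A -> B) : f =1 g -> computable f -> computable g.
Proof. by move=> fg [f' r e]; exists f' => // a; rewrite e fg. Qed.

Lemma computable_comp (f : B -> C) (g : A -> B) :
  computable f -> computable g -> computable (fun a => f (g a)).
Proof.
move=> [f' rf ef] [g' rg eg]; exists (f' \o g'); first exact: rec1_comp.
by move=> a /=; rewrite eg ef.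
Qed.

Lemma computable_id : computable (fun a : A => a).
Proof. by exists id => //; exact: rec1_id. Qed.

Lemma computable_cst (b : B) : computable (fun _ : A => b).
Proof. by exists (fun=> enc b) => //; exact: rec1_cst. Qed.

Lemma computable_pair (f : A -> B) (g : A -> C) :
  computable f -> computable g -> computable (fun a => (f a, g a)).
Proof.
move=> [f' rf ef] [g' rg eg]; exists (fun n => npair (f' n) (g' n)).
  exact: rec2_comp rec2_npair rf rg.
by move=> a /=; rewrite ef eg.
Qed.

End Basics.

Section Combinators.
Context {A B C D : Type} {cA : coding A} {cB : coding B} {cC : coding C}
  {cD : coding D}.

Lemma computable_fst (f : A -> B * C) :
  computable f -> computable (fun a => (f a).1).
Proof.
apply: computable_comp; exists nfst; [exact: rec1_nfst|case=> a b].
exact: nfst_pair.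
Qed.

Lemma computable_snd (f : A -> B * C) :
  computable f -> computable (fun a => (f a).2).
Proof.
apply: computable_comp; exists nsnd; [exact: rec1_nsnd|case=> a b].
exact: nsnd_pair.
Qed.

Lemma computable_comp2 (f : B -> C -> D) (g : A -> B) (h : A -> C) :
  computable (fun p : B * C => f p.1 p.2) -> computable g -> computable h ->
  computable (fun a => f (g a) (h a)).
Proof.
by move=> rf rg rh; apply: (computable_comp rf (computable_pair rg rh)).
Qed.

Lemma computable_if (c : A -> bool) (f g : A -> B) :
  computable c -> computable f -> computable g ->
  computable (fun a => if c a then f a else g a).
Proof.
move=> [c' rc ec] [f' rf ef] [g' rg eg].
exists (fun n => if c' n == 0 then g' n else f' n); first exact: rec1_if.
by move=> a; rewrite ec ef eg /=; case: (c a).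
Qed.

Lemma computable_cons (f : A -> B) (g : A -> seq B) :
  computable f -> computable g -> computable (fun a => f a :: g a).
Proof.
move=> [f' rf ef] [g' rg eg]; exists (fun n => npair (f' n) (g' n)).
  exact: rec2_comp rec2_npair rf rg.
by move=> a /=; rewrite ef eg.
Qed.

Lemma computable_iter (n : A -> nat) (f : A -> B -> B) (g : A -> B) :
  computable n -> computable (fun p : A * B => f p.1 p.2) -> computable g ->
  computable (fun a => iter (n a) (f a) (g a)).
Proof.
move=> [n' rn en] [f' rf ef] [g' rg eg].
(* The parameter [a] travels unchanged in the first component of the state, as [rec2_iter] iterates
   a map without parameters. *)
have rs : rec1 (fun m => npair (nfst m) (f' m)).
  exact: rec2_comp rec2_npair rec1_nfst rf.
eexists.
  exact: rec1_comp rec1_nsnd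
    (rec2_comp (rec2_iter rs) rn (rec2_comp rec2_npair rec1_id rg)).
move=> a; rewrite /= en eg.
have iterE k : iter k (fun m => npair (nfst m) (f' m)) (npair (enc a) (enc (g a)))
  = npair (enc a) (enc (iter k (f a) (g a))).
  elim: k => //= k ->; rewrite nfst_pair; congr npair.
  exact: (ef (a, _)).
by rewrite iterE nsnd_pair.
Qed.

Lemma computable_foldl (f : A -> B -> C -> B) (z : A -> B) (s : A -> seq C) :
  computable (fun p : A * C * B => f p.1.1 p.2 p.1.2) -> computable z ->
  computable s -> computable (fun a => foldl (f a) (z a) (s a)).
Proof.
move=> [f' rf ef] [z' rz ez] [s' rs es].
(* States are (list, (a, accumulator)); the empty list is a fixed point, so that
   iterating [enc (s a)] times, at least the length of the list, is enough. *)
pose step m := if nfst m == 0 then m else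
  npair (nsnd (nfst m)) (npair (nfst (nsnd m))
     (f' (npair (npair (nfst (nsnd m)) (nfst (nfst m))) (nsnd (nsnd m))))).
have rstep : rec1 step.
  have r1 := rec1_nfst; have r2 := rec1_nsnd.
  have r11 := rec1_comp r1 r1; have r12 := rec1_comp r1 r2.
  have r21 := rec1_comp r2 r1; have r22 := rec1_comp r2 r2.
  apply: (rec1_if rec1_nfst _ rec1_id).
  apply: (rec2_comp rec2_npair r21 (rec2_comp rec2_npair r12 _)).
  apply: (rec1_comp rf).
  exact: (rec2_comp rec2_npair (rec2_comp rec2_npair r12 r11) r22).
eexists.
  apply: (rec1_comp rec1_nsnd (rec1_comp rec1_nsnd _)).
  exact: (rec2_comp (rec2_iter rstep) rs
    (rec2_comp rec2_npair rs (rec2_comp rec2_npair rec1_id rz))).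
move=> a; rewrite /= es ez.
have : size (s a) <= enc (s a) by rewrite -(size_map enc) size_code.
(* The iteration count becomes an arbitrary [k] bounding the length, separate from the code stored
   in the state; the induction on the list needs this freedom. *)
move: {1 2}(enc (s a)) => k.
elim: (s a) (z a) k => [|c l IH] b k /=.
  have -> : iter k step (npair 0 (npair (enc a) (enc b))) =
      npair 0 (npair (enc a) (enc b)).
    by elim: k => //= k ->; rewrite /step nfst_pair.
  by rewrite !nsnd_pair.
case: k => // k lk; rewrite iterSr /step !(nfst_pair, nsnd_pair).
rewrite -if_neg -lt0n npair_gt0 -/step.
by rewrite (ef (a, c, b)) IH.
Qed.

End Combinators.

Section Binary.
Context {A B : Type} {cA : coding A} {cB : coding B}.

Lemma computable_rec2 f (g h : A -> nat) : rec2 f ->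
  computable g -> computable h -> computable (fun a => f (g a) (h a)).
Proof.
move=> rf [g' rg eg] [h' rh eh]; exists (fun n => f (g' n) (h' n)).
  exact: rec2_comp.
by move=> a; rewrite eg eh.
Qed.

Lemma computable_rev (s : A -> seq B) : computable s -> computable (fun a => rev (s a)).
Proof.
move=> cs; apply: computable_ext (computable_foldl (f := fun _ t c => c :: t)
    _ (computable_cst [::]) cs).
  by move=> a; rewrite /rev; elim: (s a) [::] => //= c l IH t.
by apply: computable_cons;
  [apply: computable_snd; apply: computable_fst|apply: computable_snd];
  exact: computable_id.
Qed.

End Binary.

Section Arithmetic.
Context {A B C : Type} {cA : coding A} {cB : coding B} {cC : coding C}.

Lemma computable_succ (f : A -> nat) : computable f -> computable (fun a => (f a).+1).
Proof. by apply: computable_comp; exists S => //; exact: rec1_succ. Qed.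

Lemma computable_muln (f g : A -> nat) :
  computable f -> computable g -> computable (fun a => f a * g a).
Proof.
move=> cf cg.
apply: computable_ext (computable_iter (f := fun a n => g a + n)
  (g := fun=> 0) cf _ (computable_cst _)) => [a|].
  by elim: (f a) => //= n ->; rewrite mulSn.
apply: (computable_rec2 rec2_add); first exact: computable_comp (computable_fst computable_id).
exact: computable_snd computable_id.
Qed.

Lemma computable_eq (E : eqType) (cE : coding E) (f g : A -> E) :
  computable f -> computable g -> computable (fun a => f a == g a).
Proof.
move=> [f' rf ef] [g' rg eg]; exists (fun n => f' n == g' n); first exact: rec1_eq.
by move=> a; rewrite ef eg /= (inj_eq enc_inj).
Qed.

Lemma computable_neg (f : A -> bool) : computable f -> computable (fun a => ~~ f a).
Proof. by move=> cf; apply: computable_if cf (computable_cst _) (computable_cst _). Qed.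

Lemma computable_and (f g : A -> bool) :
  computable f -> computable g -> computable (fun a => f a && g a).
Proof. by move=> cf cg; apply: computable_if cf cg (computable_cst _). Qed.

Lemma computable_or (f g : A -> bool) :
  computable f -> computable g -> computable (fun a => f a || g a).
Proof. by move=> cf cg; apply: computable_if cf (computable_cst _) cg. Qed.

Lemma computable_leq (f g : A -> nat) :
  computable f -> computable g -> computable (fun a => f a <= g a).
Proof.
move=> cf cg; apply: computable_eq (computable_cst _).
exact: (computable_rec2 rec2_sub).
Qed.

(** A lookup table: nested tests on the code, built along [enum L]. *)
Lemma computable_finite (L : finType) (cL : coding L) (f : L -> B) : computable f.
Proof.
have [f' rf ef] : exists2 f', rec1 f' &
    forall l, l \in enum L -> f' (enc l) = enc (f l).
  elim: (enum L) => [|l s [f' rf ef]]; first by exists id => //; exact: rec1_id.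
  exists (fun n => if (n == enc l : nat) == 0 then f' n else enc (f l)).
    apply: rec1_if rf; last exact: rec1_cst.
    by apply: rec1_eq; [exact: rec1_id | exact: rec1_cst].
  move=> k; rewrite inE => /predU1P[->|ks] /=; first by rewrite eqxx.
  by rewrite (inj_eq enc_inj); case: (eqVneq k l) => [->|_] //=; exact: ef.
by exists f' => // l; rewrite ef ?mem_enum.
Qed.

Lemma computable_foldr (f : A -> C -> B -> B) (z : A -> B) (s : A -> seq C) :
  computable (fun p : A * C * B => f p.1.1 p.1.2 p.2) -> computable z ->
  computable s -> computable (fun a => foldr (f a) (z a) (s a)).
Proof.
move=> cf cz cs.
apply: computable_ext (computable_foldl (f := fun a b c => f a c b) cf cz (computable_rev cs)).
by move=> a; rewrite foldl_rev.
Qed.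

End Arithmetic.

(** * Computable operations on lists *)

Section Lists.
Context {A B C : Type} {cA : coding A} {cB : coding B} {cC : coding C}.

Lemma computable_cat (f g : A -> seq B) :
  computable f -> computable g -> computable (fun a => f a ++ g a).
Proof.
move=> cf cg.
apply: computable_ext (computable_foldr (f := fun _ x t => x :: t) _ cg cf).
  by move=> a; elim: (f a) => //= x s ->.
apply: computable_cons.
  exact: computable_snd (computable_fst computable_id).
exact: computable_snd computable_id.
Qed.

Lemma computable_map (f : A -> B -> C) (s : A -> seq B) :
  computable (fun p : A * B => f p.1 p.2) -> computable s ->
  computable (fun a => map (f a) (s a)).
Proof.
move=> cf cs.
apply: computable_ext (computable_foldr (f := fun a x t => f a x :: t)
  _ (computable_cst [::]) cs).
  by move=> a; elim: (s a) => //= x t ->.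
apply: computable_cons.
  exact: computable_comp cf (computable_fst computable_id).
exact: computable_snd computable_id.
Qed.

Lemma computable_count (f : A -> B -> bool) (s : A -> seq B) :
  computable (fun p : A * B => f p.1 p.2) -> computable s ->
  computable (fun a => count (f a) (s a)).
Proof.
move=> cf cs.
apply: computable_ext (computable_foldr (f := fun a x n => f a x + n)
  _ (computable_cst 0) cs).
  by move=> a; elim: (s a) => //= x t ->.
apply: (computable_rec2 rec2_add (g := fun p => nat_of_bool (f p.1.1 p.1.2))).
  apply: (computable_comp (f := nat_of_bool)).
    by exists id; [exact: rec1_id|].
  exact: computable_comp cf (computable_fst computable_id).
exact: computable_snd computable_id.
Qed.

Lemma computable_size (s : A -> seq B) :
  computable s -> computable (fun a => size (s a)).
Proof.
move=> cs; apply: computable_ext (computable_count (f := fun _ => predT)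
  (computable_cst true) cs) => a.
exact: count_predT.
Qed.

Lemma computable_has (f : A -> B -> bool) (s : A -> seq B) :
  computable (fun p : A * B => f p.1 p.2) -> computable s ->
  computable (fun a => has (f a) (s a)).
Proof.
move=> cf cs; apply: computable_ext (fun a => esym (has_count _ _)) _.
exact: computable_leq (computable_cst _) (computable_count cf cs).
Qed.

Lemma computable_all (f : A -> B -> bool) (s : A -> seq B) :
  computable (fun p : A * B => f p.1 p.2) -> computable s ->
  computable (fun a => all (f a) (s a)).
Proof.
move=> cf cs; apply: computable_ext (fun a => esym (all_count _ _)) _.
exact: computable_eq (computable_count cf cs) (computable_size cs).
Qed.

End Lists.

Lemma computable_mem A (cA : coding A) (E : eqType) (cE : coding E) (f : A -> E) (s : A -> seq E) :
  computable f -> computable s -> computable (fun a => f a \in s a).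
Proof.
move=> cf cs; apply: computable_ext (fun a => has_pred1 _ _) _.
apply: (computable_has (f := fun a x => x == f a)) cs.
apply: computable_eq; first exact: computable_snd computable_id.
exact: computable_comp cf (computable_fst computable_id).
Qed.

(* The search must succeed on every natural number, not only on the codes of
   some type, hence the domain nat. *)
Lemma computable_search (P : nat -> nat -> bool) :
  computable (fun p : nat * nat => P p.1 p.2) -> (forall n, exists m, P n m) ->
  exists2 g : nat -> nat, computable g & forall n, P n (g n).
Proof.
move=> [P' rP eP] exP; pose g n := ex_minn (exP n).
exists g => [|n]; last by rewrite /g; case: ex_minnP.
(* Minimization looks for a zero, hence the complemented test [1 - P']; [ex_minn] supplies the
   minimality. *)
exists g => //; apply: (@rec1_mu (fun m n => 1 - P' (npair n m))) => [|n|n m].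
- apply: (recursive_rec2 rec2_sub); first exact: recursive_cst.
  apply: (recursive_rec1 rP).
  by apply: (recursive_rec2 rec2_npair); exact: recursive_nth.
- by rewrite (eP (n, g n)) /g; case: ex_minnP => m /= ->.
rewrite (eP (n, m)) /g; case: ex_minnP => k /= Pk mink mk.
by case Pm: (P n m) => //; have := mink _ Pm; rewrite leqNgt mk.
Qed.

(** [CodeSeq] is a bijection between naturals and sequences of naturals, so the identity is a
    realizer. *)
Lemma computable_decode : computable CodeSeq.decode.
Proof.
by exists id; [exact: rec1_id | move=> n; rewrite /= map_id CodeSeq.decodeK].
Qed.

Lemma computable_nfst : computable nfst.
Proof. by exists nfst; first exact: rec1_nfst. Qed.

Lemma computable_nsnd : computable nsnd.
Proof. by exists nsnd; first exact: rec1_nsnd. Qed.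

Section ListAccess.
Context {A B : Type} {cA : coding A} {cB : coding B}.

Lemma computable_head (b : A -> B) (s : A -> seq B) :
  computable b -> computable s -> computable (fun a => head (b a) (s a)).
Proof.
move=> cb cs; apply: computable_ext (computable_foldr (f := fun _ c _ => c) _ cb cs).
  by move=> a; case: (s a).
exact: computable_snd (computable_fst computable_id).
Qed.

Lemma computable_behead (s : A -> seq B) :
  computable s -> computable (fun a => behead (s a)).
Proof.
apply: computable_comp; exists nsnd; first exact: rec1_nsnd.
by case=> [|b t] //; exact: nsnd_pair.
Qed.

Lemma computable_filter (f : A -> B -> bool) (s : A -> seq B) :
  computable (fun p : A * B => f p.1 p.2) -> computable s ->
  computable (fun a => filter (f a) (s a)).
Proof.
move=> cf cs; apply: computable_ext (computable_foldr
  (f := fun a b t => if f a b then b :: t else t) _ (computable_cst [::]) cs).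
  by move=> a; elim: (s a) => //= b t ->.
have c12 : computable (fun p : A * B * seq B => p.1.2).
  exact: computable_snd (computable_fst computable_id).
have c2 : computable (fun p : A * B * seq B => p.2).
  exact: computable_snd computable_id.
apply: computable_if (computable_cons c12 c2) c2.
exact: computable_comp cf (computable_fst computable_id).
Qed.

End ListAccess.

(** * Automation: computability read off from the shape of an expression *)

Ltac computable_step :=
  lazymatch goal with
  | |- @computable _ _ _ _ (fun x => x) => exact: computable_id
  | |- @computable _ _ _ _ fst => exact: (computable_fst computable_id)
  | |- @computable _ _ _ _ snd => exact: (computable_snd computable_id)
  | |- @computable _ _ _ _ (fun _ => ?c) => exact: computable_cst
  | |- @computable _ _ _ _ (fun x => fst _) => apply: computable_fst
  | |- @computable _ _ _ _ (fun x => snd _) => apply: computable_snd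
  | |- @computable _ _ _ _ (fun x => pair _ _) => apply: computable_pair
  | |- @computable _ _ _ _ (fun x => cons _ _) => apply: computable_cons
  | |- @computable _ _ _ _ (fun x => cat _ _) => apply: computable_cat
  | |- @computable _ _ _ _ (fun x => rev _) => apply: computable_rev
  | |- @computable _ _ _ _ (fun x => head _ _) => apply: computable_head
  | |- @computable _ _ _ _ (fun x => behead _) => apply: computable_behead
  | |- @computable _ _ _ _ (fun x => filter _ _) => apply: computable_filter
  | |- @computable _ _ _ _ (fun x => size _) => apply: computable_size
  | |- @computable _ _ _ _ (fun x => count _ _) => apply: computable_count
  | |- @computable _ _ _ _ (fun x => all _ _) => apply: computable_all
  | |- @computable _ _ _ _ (fun x => has _ _) => apply: computable_has
  | |- @computable _ _ _ _ (fun x => map _ _) => apply: computable_map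
  | |- @computable _ _ _ _ (fun x => if _ then _ else _) => apply: computable_if
  | |- @computable _ _ _ _ (fun x => negb _) => apply: computable_neg
  | |- @computable _ _ _ _ (fun x => andb _ _) => apply: computable_and
  | |- @computable _ _ _ _ (fun x => orb _ _) => apply: computable_or
  | |- @computable _ _ _ _ (fun x => leq _ _) => apply: computable_leq
  | |- @computable _ _ _ _ (fun x => eq_op _ _) => apply: computable_eq
  | |- @computable _ _ _ _ (fun x => muln _ _) => apply: computable_muln
  | |- @computable _ _ _ _ (fun x => S _) => apply: computable_succ
  | |- @computable _ _ _ _ (fun x => in_mem _ (mem _)) => apply: computable_mem
  end.

Ltac computable := repeat (cbv beta; first [assumption | computable_step]).

(** * The free group *)

Section FreeGroupCoding.
Variable T : finType.

Lemma letter_code_inj : injective (@letter_code T).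
Proof.
move=> [x b] [y c] e; have := congr1 odd e; have := congr1 half e.
rewrite /letter_code /= !oddD !odd_double !oddb /= => + bc.
by rewrite bc ![(_.*2 + _)%N]addnC !half_bit_double => /ord_inj/enum_rank_inj->.
Qed.
#[export] Instance coding_letter : coding (T * bool) := Coding letter_code_inj.

Lemma word_code_inj : injective (@word_code T).
Proof. by move=> u v e; apply: val_inj; apply: (enc_inj (A := seq (T * bool))). Qed.
#[export] Instance coding_freeGroup : coding (freeGroup T) := Coding word_code_inj.

Context {A : Type} {cA : coding A}.

(** A free group element and its underlying word have the same code, so the identity realizes the
    passage in both directions. *)
Lemma computable_word (f : A -> freeGroup T) :
  computable f -> computable (fun a => word (f a)).
Proof. by apply: computable_comp; exists id; first exact: rec1_id. Qed.

Lemma computable_freeGroup (f : A -> freeGroup T) :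
  computable (fun a => word (f a)) -> computable f.
Proof. by case=> f' rf ef; exists f'. Qed.

(** Replaces pattern matching by list operations known to be computable. The default [a] of [head]
    is safe: no letter is its own inverse, so an empty [w] falls into the second branch. *)
Lemma pushE (a : T * bool) w :
  push a w = if head a w == letter_inv a then behead w else a :: w.
Proof. by case: w => //=; case: a => x [|] /=; rewrite /letter_inv xpair_eqE andbF. Qed.

End FreeGroupCoding.

Section FreeGroupComputable.
Context {T : finType} {A : Type} {cA : coding A}.

Lemma computable_letter_inv (f : A -> T * bool) :
  computable f -> computable (fun a => letter_inv (f a)).
Proof.
apply: computable_comp; exact: computable_finite.
Qed.

Lemma computable_push (f : A -> T * bool) (g : A -> seq (T * bool)) :
  computable f -> computable g -> computable (fun a => push (f a) (g a)).
Proof.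
move=> cf cg; apply: computable_ext (fun a => esym (pushE _ _)) _.
have ci := computable_letter_inv cf.
by computable.
Qed.
End FreeGroupComputable.

Section FreeGroupOps.
Context {T : finType} {A : Type} {cA : coding A}.

Lemma computable_word_mul (f g : A -> seq (T * bool)) :
  computable f -> computable g -> computable (fun a => word_mul (f a) (g a)).
Proof.
move=> cf cg; apply: (computable_foldr (f := fun _ => @push T) _ cg cf).
by apply: computable_push; computable.
Qed.

Lemma computable_mulg (f g : A -> freeGroup T) :
  computable f -> computable g -> computable (fun a => f a * g a)%g.
Proof.
move=> cf cg; apply: computable_freeGroup.
exact: computable_word_mul (computable_word cf) (computable_word cg).
Qed.

Lemma computable_invg (f : A -> freeGroup T) :
  computable f -> computable (fun a => (f a)^-1)%g.
Proof.
move=> cf; apply: computable_freeGroup; apply: computable_rev.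
apply: computable_map (computable_word cf).
by apply: computable_letter_inv; computable.
Qed.

End FreeGroupOps.

(** * Total decoding of numbers into free group elements *)

Section Decoding.
Variable T : finType.

(* Numerals that encode no letter are skipped and the result is reduced, so
   that every natural number decodes to an element of the free group. *)
Definition fg_decode (m : nat) : freeGroup T :=
  FreeGroup (word_mul_reduced
    (flatten [seq [seq l <- enum {: T * bool} | letter_code l == n] | n <- CodeSeq.decode m])
    (isT : reduced [::])).

Lemma fg_decodeK u : fg_decode (word_code u) = u.
Proof.
apply: val_inj; rewrite /= CodeSeq.codeK -map_comp.
rewrite (eq_map (g := fun l => [:: l])); last first.
  move=> l /=; rewrite -[RHS](filter_pred1_uniq (enum_uniq _) (mem_enum _ l)).
  by apply: eq_filter => k /=; rewrite (inj_eq (@letter_code_inj T)).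
by rewrite flatten_seq1 word_mulw1 // (valP u).
Qed.

Definition words_decode (m : nat) := map fg_decode (CodeSeq.decode m).

Lemma words_decodeK s : words_decode (words_code s) = s.
Proof. by rewrite /words_decode CodeSeq.codeK mapK //; exact: fg_decodeK. Qed.

Context {A : Type} {cA : coding A}.

Lemma computable_fg_decode (f : A -> nat) :
  computable f -> computable (fun a => fg_decode (f a)).
Proof.
apply: computable_comp; apply: computable_freeGroup => /=.
apply: computable_word_mul; last exact: computable_cst.
apply: computable_ext (computable_foldr (f := fun _ x t => x ++ t) (z := fun=> [::])
  (s := fun m => [seq [seq l <- enum {: T * bool} | letter_code l == n]
                     | n <- CodeSeq.decode m]) _ _ _) => [a||| ]; computable.
- by elim: [seq _ | _ <- _] => //= x t ->.
- apply: (computable_comp (f := @letter_code T)); last by computable.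
  exact: computable_finite.
- exact: computable_decode.
Qed.
End Decoding.

(** * Normal closures and Folner sets *)

Section NormalClosure.
Local Open Scope group_scope.
Local Open Scope fset_scope.
Variables (G : groupType) (R : set G).

(* Every sequence of pairs yields an element of the normal closure: pairs whose
   second component is not in R or its inverse count as 1. *)
Definition relator (r : G) : G := if (r \in R) || (r^-1 \in R) then r else 1.

Definition relator_prod (c : seq (G * G)) : G :=
  foldr (fun p u => relator p.2 ^ p.1 * u) 1 c.

Lemma relator_prod_cat c d :
  relator_prod (c ++ d) = relator_prod c * relator_prod d.
Proof. by elim: c => [|p c IH] /=; [rewrite mul1g | rewrite IH mulgA]. Qed.

Lemma relatorV r : relator r^-1 = (relator r)^-1.
Proof. by rewrite /relator invgK orbC; case: ifP => // _; rewrite invg1. Qed.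

Lemma relator_prodV c :
  relator_prod (rev [seq (p.1, p.2^-1) | p <- c]) = (relator_prod c)^-1.
Proof.
elim: c => [|p c IH] /=; first by rewrite invg1.
by rewrite rev_cons -cats1 relator_prod_cat IH /= mulg1 relatorV conjVg [RHS]invgM.
Qed.

Lemma relator_prodJ c h :
  relator_prod [seq (p.1 * h, p.2) | p <- c] = relator_prod c ^ h.
Proof. by elim: c => [|p c IH] /=; [rewrite conj1g | rewrite IH conjgM [RHS]conjMg]. Qed.

(** The values of [relator_prod] form a normal subgroup containing [R]: concatenation gives
    products, reversal with inverted relators gives inverses, and multiplying all conjugators by [h]
    gives conjugates. *)
Lemma normal_closure_relator_prod u :
  normal_closure R u -> exists c, relator_prod c = u.
Proof.
pose N : set G := [set v | exists c, relator_prod c = v]%classic.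
move=> /(_ N); apply; split=> [|r Rr]; last first.
  by exists [:: (1, r)]; rewrite /= mulg1 conjg1 /relator mem_set.
split; first split; first by exists [::].
- move=> _ _ [c <-] [d <-]; eexists; rewrite -relator_prodV.
  exact: relator_prod_cat.
- by move=> _ h [c <-]; eexists; exact: relator_prodJ.
Qed.

Lemma sub_normal_closure : (R `<=` normal_closure R)%classic.
Proof. by move=> r Rr N [_]; apply. Qed.

Lemma normal_closure_id : normal_subgroup R -> normal_closure R = R.
Proof.
move=> nR; apply/seteqP; split; last exact: sub_normal_closure.
by move=> u /(_ R); apply; split.
Qed.

End NormalClosure.

(** * Følner sets and almost invariance under words *)

Section Folner.
Local Open Scope group_scope.
Local Open Scope fset_scope.
Variables (G : groupType).
Implicit Types (x y : G) (Omega : {fset G}).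

(** The numerator of the Følner ratio, for any group element [x]. Subadditivity and symmetry in [x]
    bound it linearly in word length. *)
Definition defect Omega x := #|` Omega `\` [fset x * g | g in Omega] |.

(** Clearing denominators leaves an inequality between naturals, which a recursive function can
    test. *)
Lemma folner_setP (X : {fset G}) n Omega : (0 < n)%N ->
  folner_set X n Omega <->
  Omega != fset0 /\
  forall x, x \in X -> (defect Omega x * n <= #|` Omega|)%N.
Proof.
have frac_leq a b : (0 < n)%N -> (0 < b)%N ->
    (a%:R / b%:R <= n%:R^-1 :> rat)%R = (a * n <= b)%N.
  move=> n0 b0; rewrite Num.Theory.ler_pdivrMr ?Num.Theory.ltr0n //.
  rewrite GRing.mulrC Num.Theory.ler_pdivlMr ?Num.Theory.ltr0n //.
  by rewrite -GRing.natrM Num.Theory.ler_nat.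
move=> n0; split=> -[O0 fO]; split=> // x /fO.
  by rewrite frac_leq // lt0n cardfs_eq0.
by rewrite frac_leq // lt0n cardfs_eq0.
Qed.

Lemma card_translate Omega x : #|` [fset x * g | g in Omega]| = #|` Omega|.
Proof. by rewrite card_imfset //; exact: mulgI. Qed.

(** A point of [Omega] outside [xy Omega] lies either outside [x Omega] or in the translate by [x]
    of the part of [Omega] outside [y Omega]. *)
Lemma defectM Omega x y : (defect Omega (x * y) <= defect Omega x + defect Omega y)%N.
Proof.
rewrite [defect _ y]/defect -(card_translate _ x).
apply: leq_trans (leq_card_fsetU _ _).
apply: fsubset_leq_card; apply/fsubsetP => g.
rewrite !inE => /andP[xyg ->]; rewrite andbT.
have [/imfsetP[h /= hO gE]|//] := boolP (g \in [fset x * g | g in Omega]).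
apply/imfsetP; exists h; rewrite //= !inE hO andbT.
apply: contra xyg => /imfsetP[k /= kO e].
by apply/imfsetP; exists k => //=; rewrite gE e mulgA.
Qed.

(** Translation by [x] carries the intersection of [Omega] with [x^-1 Omega] onto that of [Omega]
    with [x Omega]. *)
Lemma defectV Omega x : defect Omega x^-1 = defect Omega x.
Proof.
rewrite /defect !cardfsD; congr (_ - _)%N.
rewrite -[LHS](card_translate _ x); congr #|` _|; apply/fsetP => g.
rewrite inE; apply/imfsetP/andP => /=.
  move=> [h]; rewrite inE => /andP[hO /imfsetP[k /= kO e]] ->.
  split; last by apply/imfsetP; exists h.
  by rewrite e mulVKg.
move=> [gO /imfsetP[h /= hO e]]; exists h => //.
rewrite inE hO; apply/imfsetP; exists g => //=.
by rewrite e mulKg.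
Qed.

Lemma defect1 Omega : defect Omega 1 = 0.
Proof.
apply/eqP; rewrite cardfs_eq0; apply/eqP/fsetP => g.
rewrite !inE; apply/negP => /andP[/imfsetP H gO]; apply: H.
by exists g => //; rewrite mul1g.
Qed.

(** Turns the defect into a count over a list, which the search for Følner sets can evaluate. *)
Lemma defect_seq (l : seq G) x : uniq l ->
  defect [fset g in l] x = count (fun g => ~~ has (fun h => x * h == g) l) l.
Proof.
move=> ul; rewrite -size_filter -[filter _ l]undup_id ?filter_uniq // -card_fseq.
rewrite /defect; congr #|` _|; apply/fsetP => g.
rewrite !inE mem_filter; congr (~~ _ && _).
apply/imfsetP/hasP => -[h /= hl]; last by move=> /eqP <-; exists h; rewrite ?inE.
by move=> ->; exists h => //; rewrite inE in hl.
Qed.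

Lemma folner_meet (T : finType) (X : {fset G}) (iota : T -> X) n Omega
    (w : freeGroup T) :
  (size (word w) < n)%N -> folner_set X n Omega ->
  exists2 g, g \in Omega & fg_proj iota w * g \in Omega.
Proof.
move=> wn /(folner_setP _ _ (leq_ltn_trans (leq0n _) wn))[O0 fO].
have letter_defect a : (defect Omega (eval_letter iota a) * n <= #|` Omega|)%N.
  by rewrite /eval_letter; case: a.2; rewrite ?defectV fO //; exact: valP.
(* Induction on the word: by [defectM] each letter adds at most its own defect, and [n] times that
   is at most the size of [Omega]. *)
have word_defect : (defect Omega (fg_proj iota w) * n <= size (word w) * #|` Omega|)%N.
  rewrite /fg_proj; elim: (word w) => [|a v IH] /=.
    by rewrite big_nil defect1.
  rewrite big_cons mulSn; apply: leq_trans (leq_add (letter_defect a) IH).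
  by rewrite -mulnDl leq_mul2r defectM orbT.
have c0 : (0 < #|` Omega|)%N by rewrite lt0n cardfs_eq0.
have lt_defect : (defect Omega (fg_proj iota w) < #|` Omega|)%N.
  rewrite -(ltn_pmul2r (leq_ltn_trans (leq0n _) wn)).
  by apply: leq_ltn_trans word_defect _; rewrite mulnC ltn_pmul2l.
(* An empty intersection would make the defect equal to the size of [Omega]. *)
have : #|` Omega `&` [fset fg_proj iota w * g | g in Omega]| != 0.
  move: lt_defect; rewrite /defect cardfsD; case: #|` _ `&` _| => // .
  by rewrite subn0 ltnn.
rewrite cardfs_eq0 => /fset0Pn[h]; rewrite inE => /andP[hO /imfsetP[g /= gO e]].
by exists g; rewrite -?e.
Qed.

End Folner.

(** * The projection from the free group and its kernel *)

Section Projection.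
Local Open Scope group_scope.
Local Open Scope fset_scope.
Variables (G : groupType) (X : {fset G}) (T : finType) (iota : T -> X).

Lemma fg_proj1 : fg_proj iota 1 = 1.
Proof. exact: big_nil. Qed.

HB.instance Definition _ :=
  Multiplicative_isUMagmaMorphism.Build (freeGroup T) G (fg_proj iota) fg_proj1.

Definition letter_word (t : T) : freeGroup T := FreeGroup (isT : reduced [:: (t, false)]).

Lemma fg_proj_letter t : fg_proj iota (letter_word t) = val (iota t).
Proof. by rewrite /fg_proj big_seq1. Qed.

(** The image of the projection is a subgroup containing [X]. *)
Lemma fg_proj_surj : bijective iota -> generated_by X ->
  forall g : G, exists u, fg_proj iota u = g.
Proof.
move=> [iota' _ iotaK] gX g.
have : [set: G]%classic g by [].
rewrite -gX => /(_ [set g | exists u, fg_proj iota u = g]%classic); apply; split.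
  split; first by exists 1; rewrite /= gmulf1.
  by move=> _ _ [u <-] [v <-]; exists (u / v); rewrite gmulfF.
move=> x /= xX; exists (letter_word (iota' [` xX])).
by rewrite fg_proj_letter iotaK.
Qed.

Lemma fg_ker_normal : normal_subgroup (fg_ker iota).
Proof.
rewrite /fg_ker; split; first split=> [|u v /= u1 v1] /=.
- exact: gmulf1.
- by rewrite gmulfF /= u1 v1 divg1.
by move=> u v /= u1; rewrite gmulfJ /= u1 conj1g.
Qed.

(** Reduces equality in [G] to membership in the kernel, the question that the word problem
    answers. *)
Lemma mem_fg_ker u v : (u^-1 * v \in fg_ker iota) = (fg_proj iota v == fg_proj iota u).
Proof.
apply/idP/eqP; rewrite in_setE /fg_ker /= gmulfM gmulfV /=.
  by move/(canRL (mulKg _)); rewrite invgK mulg1.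
by move=> ->; rewrite mulVg.
Qed.

(** Soundness of certificates: [c] may be any list of pairs, since pairs without a relator count as
    1. *)
Lemma fg_proj_relator_prod (R : set (freeGroup T)) c :
  (R `<=` fg_ker iota)%classic -> fg_proj iota (relator_prod R c) = 1.
Proof.
move=> kerR.
have rel1 r : fg_proj iota (relator R r) = 1.
  rewrite /relator; case: ifP => [/orP[]|_]; last exact: fg_proj1.
    by rewrite in_setE => /kerR.
  by rewrite in_setE => /kerR; rewrite /fg_ker /= gmulfV /= => /eqP; rewrite invg_eq1 => /eqP.
elim: c => [|p c IH]; first exact: fg_proj1.
by rewrite /= gmulfM gmulfJ /= rel1 conj1g IH mulg1.
Qed.

End Projection.

(** * Deciding the word problem and finding Folner sets *)

Lemma tuple1E (t : 1.-tuple nat) : [tuple nth 0 t 0] = t.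
Proof. by case: t => -[|a []] // i; apply: val_inj. Qed.

Lemma recursive_computable (f : 1.-tuple nat -> nat) :
  recursive f -> computable (fun n => f [tuple n]).
Proof.
by move=> rf; exists (fun n => f [tuple n]) => //;
  apply: recursive_ext rf => t; rewrite tuple1E.
Qed.

Lemma computable_recursive (f : nat -> nat) :
  computable f -> recursive (fun t : 1.-tuple nat => f (nth 0 t 0)).
Proof. by move=> [f' rf ef]; apply: recursive_ext rf => t; rewrite (ef). Qed.

Section Sets.
Local Open Scope group_scope.
Variable T : finType.

Lemma recursive_set_computable (S : set (freeGroup T)) :
  recursive_set S -> computable (fun u : freeGroup T => u \in S).
Proof.
move=> [f rf ef]; exists (fun n => f [tuple n]) => //.
by apply: recursive_ext rf => t; rewrite tuple1E.
Qed.

Lemma computable_recursive_set (S : set (freeGroup T)) :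
  computable (fun u : freeGroup T => u \in S) -> recursive_set S.
Proof. by move=> [f rf ef]; exists (fun t => f (nth 0 t 0)%N). Qed.

Definition cert_decode (m : nat) : seq (freeGroup T * freeGroup T) :=
  [seq (fg_decode T (nfst n), fg_decode T (nsnd n)) | n <- CodeSeq.decode m].

(** Completeness of the search: running through all naturals meets every product of conjugates of
    relators. *)
Lemma cert_decode_surj c : exists m, cert_decode m = c.
Proof.
exists (CodeSeq.code [seq npair (word_code p.1) (word_code p.2) | p <- c]).
rewrite /cert_decode CodeSeq.codeK -map_comp -[RHS]map_id.
by apply: eq_map => -[u v] /=; rewrite nfst_pair nsnd_pair !fg_decodeK.
Qed.

Context {A : Type} {cA : coding A}.

Lemma computable_cert_decode (f : A -> nat) :
  computable f -> computable (fun a => cert_decode (f a)).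
Proof.
apply: computable_comp; rewrite /cert_decode; computable.
- by apply: computable_fg_decode; apply: (computable_comp computable_nfst); computable.
- by apply: computable_fg_decode; apply: (computable_comp computable_nsnd); computable.
- exact: computable_decode.
Qed.

Lemma computable_words_decode (f : A -> nat) :
  computable f -> computable (fun a => words_decode T (f a)).
Proof.
apply: computable_comp; rewrite /words_decode; computable.
  by apply: computable_fg_decode; computable.
exact: computable_decode.
Qed.

Lemma computable_relator_prod (R : set (freeGroup T))
    (c : A -> seq (freeGroup T * freeGroup T)) :
  recursive_set R -> computable c -> computable (fun a => relator_prod R (c a)).
Proof.
move=> /recursive_set_computable cR; apply: computable_comp.
pose t := freeGroup T.
have c_rel : computable (relator R).
  apply: computable_if; [apply: computable_or| |exact: computable_cst].
  - exact: cR.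
  - by apply: (computable_comp cR); apply: computable_invg; exact: computable_id.
  - exact: computable_id.
(* Conjugation is written out as a product so that the rules for products and inverses apply. *)
apply: (computable_foldr (f := fun _ (p : t * t) u => (p.1^-1 * (relator R p.2 * p.1) * u)%g)
  _ (computable_cst 1%g) computable_id).
apply: computable_mulg; last by computable.
apply: computable_mulg; first by apply: computable_invg; computable.
apply: computable_mulg; last by computable.
by apply: (computable_comp c_rel); computable.
Qed.

End Sets.

Section MarkedGroups.
Local Open Scope group_scope.
Local Open Scope fset_scope.
Variables (G : groupType) (X : {fset G}) (T : finType) (iota : T -> X).

Lemma folner_solvable_word_problem (f : 1.-tuple nat -> nat) :
  recursively_presentable iota -> recursive f ->
  (forall n : nat, (0 < n)%N -> exists F : {fset freeGroup T},
     [/\ codes_fset (f [tuple n]) F,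
         folner_set X n [fset fg_proj iota u | u in F]
       & #|` F| = #|` [fset fg_proj iota u | u in F]| ]) ->
  solvable_word_problem iota.
Proof.
move=> [R recR closR] recf folF.
(* A number [m] stands for the word [w], and [N] for a triple: candidates [u] and [v] in the Følner
   list, and a certificate whose product is meant to be [w u v^-1]. *)
pose w (m : nat) := fg_decode T m.
pose a (N : nat) := fg_decode T (nfst N).
pose b (N : nat) := fg_decode T (nfst (nsnd N)).
pose c (N : nat) := relator_prod R (cert_decode T (nsnd (nsnd N))).
pose F (m : nat) := words_decode T (f [tuple (size (word (w m))).+1]).
pose P (m N : nat) := [&& a N \in F m, b N \in F m & w m * a N == c N * b N].
have ca : computable a.
  by apply: computable_fg_decode; exact: computable_nfst.
have cb : computable b.
  apply: computable_fg_decode; exact: (computable_comp computable_nfst computable_nsnd).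
have cc : computable c.
  apply: computable_relator_prod recR _; apply: computable_cert_decode.
  exact: (computable_comp computable_nsnd computable_nsnd).
have cw : computable w by apply: computable_fg_decode; exact: computable_id.
have cF : computable F.
  apply: computable_words_decode; apply: (computable_comp (recursive_computable recf)).
  by computable; exact: computable_word.
(* Equality of the two cardinalities is injectivity of the projection on the list. The index, word
   length plus one, is positive and exceeds the word length, as [folner_meet] requires. *)
have FP m : exists F' : {fset freeGroup T},
    [/\ F' =i F m, folner_set X (size (word (w m))).+1 [fset fg_proj iota u | u in F']
      & {in F' &, injective (fg_proj iota)}].
  have [//|F' [[s sE Fs] folF' cardF']] := folF (size (word (w m))).+1.
  exists F'; split=> //; first by rewrite /F sE words_decodeK.
  by apply/card_in_imfsetP; rewrite cardF'.
have cP : computable (fun p : nat * nat => P p.1 p.2).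
  rewrite /P; computable.
  - by apply: (computable_comp ca); computable.
  - by apply: (computable_comp cF); computable.
  - by apply: (computable_comp cb); computable.
  - by apply: (computable_comp cF); computable.
  - apply: computable_mulg.
      by apply: (computable_comp cw); computable.
    by apply: (computable_comp ca); computable.
  - apply: computable_mulg.
      by apply: (computable_comp cc); computable.
    by apply: (computable_comp cb); computable.
have exP m : exists N, P m N.
  have [F' [F'E folF' _]] := FP m.
  have [_ /imfsetP[u /= uF ->] /imfsetP[v /= vF uv]] := folner_meet iota (ltnSn _) folF'.
  have /normal_closure_relator_prod[d dE] : normal_closure R (w m * u * v^-1).
    by rewrite closR /fg_ker /= gmulfM gmulfM gmulfV /= uv mulgV.
  have [k kE] := cert_decode_surj d.
  exists (npair (word_code u) (npair (word_code v) k)).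
  rewrite /P /a /b /c !(nfst_pair, nsnd_pair) !fg_decodeK kE dE -!F'E uF vF /=.
  by rewrite mulgVK.
have [g cg gP] := computable_search cP exP.
apply: computable_recursive_set.
apply: computable_ext (_ : computable (fun u : freeGroup T =>
  a (g (word_code u)) == b (g (word_code u)))); last first.
  have cwc : computable (@word_code T) by exists id; first exact: rec1_id.
  computable.
  - by apply: (computable_comp ca); exact: (computable_comp cg).
  - by apply: (computable_comp cb); exact: (computable_comp cg).
move=> u; set m := word_code u; have /and3P[aF bF /eqP wab] := gP m.
have [F' [F'E _ injF']] := FP m.
have projc : fg_proj iota (c (g m)) = 1.
  by apply: fg_proj_relator_prod; rewrite -closR; exact: sub_normal_closure.
have wE : w m = u by exact: fg_decodeK.
(* Projecting the equation found by the search kills the certificate. What remains says that the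
   image of [u] carries that of [a] to that of [b], so it is trivial exactly when these images
   agree, that is, when [a] and [b] agree in the free group. *)
have := congr1 (fg_proj iota) wab; rewrite !gmulfM /= projc mul1g wE => uab.
apply/eqP/idP => [ab|].
  rewrite in_setE /fg_ker /=; apply: (mulIg (fg_proj iota (a (g m)))).
  by rewrite uab ab mul1g.
rewrite in_setE /fg_ker /= => u1; apply: injF'; rewrite ?F'E //.
by rewrite -uab u1 mul1g.
Qed.

Lemma amenable_folner_function :
  bijective iota -> generated_by X -> amenable X -> solvable_word_problem iota ->
  exists2 f : 1.-tuple nat -> nat, recursive f &
     forall n : nat, (0 < n)%N -> exists F : {fset freeGroup T},
     [/\ codes_fset (f [tuple n]) F,
         folner_set X n [fset fg_proj iota u | u in F]
       & #|` F| = #|` [fset fg_proj iota u | u in F]| ].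
Proof.
move=> bij_iota genX amX /recursive_set_computable cker.
pose proj := fg_proj iota.
pose same (u v : freeGroup T) := u^-1 * v \in fg_ker iota.
pose gens := [seq letter_word t | t <- enum T].
pose outside s (x u : freeGroup T) := ~~ has (fun v => same (x * v) u) s.
(* The tests are a non-empty list, pairwise distinct images (each image occurs once), and the Følner
   inequality multiplied out. They consult [G] only through kernel membership; [PE] below restates
   them inside [G]. *)
pose P n s := [&& size s != 0, all (fun u => count (same u) s == 1) s &
  all (fun x : freeGroup T => count (outside s x) s * n <= size s) gens]%N.
pose image s := [fset g in map proj s].
have sameE u v : same u v = (proj v == proj u) by exact: mem_fg_ker.
have PE n s : P n s = [&& size s != 0, uniq (map proj s) &
    [forall t, defect (image s) (val (iota t)) * n <= size s]]%N.
  rewrite /P; congr (_ && _).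
  have -> : all (fun u => count (same u) s == 1%N) s = uniq (map proj s).
    have countE u : count (same u) s = count_mem (proj u) (map proj s).
      by rewrite count_map; apply: eq_count => v; rewrite sameE.
    apply/allP/idP => [same1|us u su]; last first.
      by rewrite countE count_uniq_mem // map_f.
    apply: count_mem_uniq => g; have [/mapP[u su ->]|/count_memPn//] := boolP (g \in _).
    by rewrite -countE; apply/eqP/same1.
  apply: andb_id2l => us; rewrite all_map.
  have defectE t : defect (image s) (val (iota t)) =
      count (outside s (letter_word t)) s.
    rewrite defect_seq // count_map; apply: eq_count => u /=.
    rewrite has_map; congr (~~ _); apply: eq_has => v /=.
    by rewrite sameE eq_sym /proj gmulfM /= fg_proj_letter.
  apply/allP/forallP => [le_t t|le_t t _] /=.
    by rewrite defectE; apply: le_t; rewrite mem_enum.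
  by have := le_t t; rewrite defectE.
have csame : computable (fun p => same p.1 p.2).
  apply: (computable_comp cker); apply: computable_mulg; last by computable.
  by apply: computable_invg; computable.
have cP : computable (fun p => P p.1 p.2).
  rewrite /P /outside; computable; apply: (computable_comp2 csame); computable.
  by apply: computable_mulg; computable.
have {}cP : computable (fun p : nat * nat => P p.1 (words_decode T p.2)).
  by apply: (computable_comp2 cP); last apply: computable_words_decode; computable.
have exP n : exists N, P n (words_decode T N).
  (* The search must also succeed at [n = 0], while amenability concerns positive indices. Hence the
     index [n.+1], whose inequality implies the one for [n]. *)
  have [Omega /(folner_setP _ _ (ltn0Sn n))[O0 fO]] := amX n.+1 (ltn0Sn n).
  have [pre preK] := choice (fg_proj_surj bij_iota genX).
  have mapK : map proj (map pre Omega) = Omega.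
    by rewrite -map_comp -[RHS]map_id; apply: eq_map.
  exists (words_code (map pre Omega)).
  have imE : image (map pre Omega) = Omega.
    by apply/fsetP => g; rewrite /image mapK inE.
  rewrite words_decodeK PE imE mapK fset_uniq size_map cardfs_eq0 O0 /=.
  apply/forallP => t.
  apply: leq_trans (fO _ (valP (iota t))).
  by rewrite leq_mul2l leqnSn orbT.
have [g cg gP] := computable_search cP exP.
(* The number found may contain numerals that encode no letter or no reduced word; decoding and
   encoding again yields the genuine code of a list that [codes_fset] demands. *)
pose f n := words_code (words_decode T (g n)).
have cf : computable f.
  apply: (computable_comp (f := @words_code T)).
    by exists id; first exact: rec1_id.
  exact: computable_words_decode.
exists (fun t => f (nth 0 t 0)%N); first exact: computable_recursive.
move=> n n0 /=; have := gP n; rewrite PE; set s := words_decode T (g n).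
move=> /and3P[s0 us /forallP defs].
have imE : [fset proj u | u in [fset u in s]] = image s.
  apply/fsetP => h; rewrite inE; apply/imfsetP/mapP => -[u /= su ->]; exists u; rewrite //=.
    by move: su; rewrite !inE.
  by rewrite inE.
exists [fset u in s]; rewrite -/proj imE !card_fseq (undup_id us) undup_id ?(map_uniq us) //.
have cardI : #|` image s| = size s by rewrite card_fseq undup_id // size_map.
split; last by rewrite (size_map proj).
  by exists s => // u; rewrite inE.
apply/(folner_setP _ _ n0); rewrite -cardfs_eq0 cardI; split=> // x xX.
have [iota' _ iotaK] := bij_iota.
by have := defs (iota' [` xX]); rewrite iotaK.
Qed.

End MarkedGroups.

Theorem theorem4p1 (Gamma : groupType) (X : {fset Gamma})
    (T : finType) (iota : T -> X) (iota_bij : bijective iota)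
    (X_gen : generated_by X) :
  (amenable X /\ solvable_word_problem iota)
  <->
  (recursively_presentable iota /\
   exists2 f : 1.-tuple nat -> nat, recursive f &
     forall n : nat, (0 < n)%N ->
       exists F : {fset freeGroup T},
         [/\ codes_fset (f [tuple n]) F,
             folner_set X n [fset fg_proj iota u | u in F]%fset
           & #|` F| = #|` [fset fg_proj iota u | u in F]%fset| ]).
Proof.
split=> [[amX wp]|[rp [f recf folF]]]; split.
- by exists (fg_ker iota) => //; apply: normal_closure_id; exact: fg_ker_normal.
- exact: amenable_folner_function.
- by move=> n /folF[F [_ folF' _]]; eexists; exact: folF'.
- exact: folner_solvable_word_problem recf folF.
Qed.
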